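(* Let $p$ be a prime and let $G=Q_{4p^2}$. Then $E(\mathcal{B}(G))<LE(\mathcal{B}(G))=LE^+(\mathcal{B}(G))$.
   Context: $Q_{4m}=\langle a,b : a^{2m}=1,\ b^2=a^m,\ bab^{-1}=a^{-1}\rangle$ is the dicyclic group of order $4m$. For a finite group $G$, let $L(G)$ be the set of all subgroups of $G$. The subgroup generating bipartite graph $\mathcal{B}(G)$ is the simple bipartite graph with vertex set the disjoint union of $G\times G$ and $L(G)$, in which $(a,b)\in G\times G$ and $H\in L(G)$ are adjacent if and only if $H$ is the subgroup generated by $a$ and $b$ (and there are no other edges). For a finite simple graph $\Gamma$ with $n$ vertices and $m$ edges, let $A$ be its adjacency matrix and $D$ its diagonal degree matrix. The energy $E(\Gamma)$ is the sum of absolute values of the eigenvalues of $A$. The Laplacian energy is $LE(\Gamma)=\sum_{\lambda}|\lambda-\frac{2m}{n}|$ over the eigenvalues $\lambda$ of $D-A$, and the signless Laplacian energy is $LE^+(\Gamma)=\sum_{\mu}|\mu-\frac{2m}{n}|$ over the eigenvalues $\mu$ of $D+A$ (all counted with multiplicity). *)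

(* Defs.v *)
From HB Require Import structures.
From mathcomp Require Import all_boot all_order all_algebra all_fingroup.

Set Implicit Arguments.
Unset Strict Implicit.
Unset Printing Implicit Defensive.

Import Order.TTheory GRing.Theory Num.Theory.

Local Open Scope ring_scope.

Record sgraph := SGraph {
  svertex :> finType;
  sedge : rel svertex;
  sedge_sym : symmetric sedge;
  sedge_irrefl : irreflexive sedge }.

Definition edges (V : sgraph) : {set {set V}} :=
  [set [set u; v] | u in V, v in V & sedge u v].

Definition degree (V : sgraph) (u : V) : nat := #|[set v | sedge u v]|.

Section Energy.
(* C plays the role of the complex numbers. On its real elements the order is
   the usual one, and `|x| is the usual absolute value. *)
Variable C : numClosedFieldType.

(* The eigenvalues of A, each repeated according to its (algebraic)
   multiplicity; the order of the list is irrelevant. *)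
Definition eigenvalues n (A : 'M[C]_n) : seq C :=
  sval (closed_field_poly_normal (char_poly A)).

Lemma eigenvaluesP n (A : 'M[C]_n) :
  char_poly A = \prod_(z <- eigenvalues A) ('X - z%:P).
Proof.
rewrite /eigenvalues; case: closed_field_poly_normal => s /= {1}->.
by rewrite (monicP (char_poly_monic A)) scale1r.
Qed.

Variable V : sgraph.

Definition adjacency_mx : 'M[C]_#|V| :=
  \matrix_(i, j) (sedge (enum_val i) (enum_val j))%:R.

Definition degree_mx : 'M[C]_#|V| :=
  diag_mx (\row_i (degree (enum_val i))%:R).

Definition average_degree : C := (2 * #|edges V|)%:R / #|V|%:R.

Definition energy : C := \sum_(x <- eigenvalues adjacency_mx) `|x|.

Definition laplacian_energy : C :=
  \sum_(x <- eigenvalues (degree_mx - adjacency_mx)) `|x - average_degree|.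

Definition signless_laplacian_energy : C :=
  \sum_(x <- eigenvalues (degree_mx + adjacency_mx)) `|x - average_degree|.

End Energy.

Section SubgroupGeneratingBipartiteGraph.
Variable gT : finGroupType.

Definition sgb_adj (u v : gT * gT + {group gT}) : bool :=
  match u, v with
  | inl (a, b), inr H | inr H, inl (a, b) => <<[set a; b]>>%g == H :> {set gT}
  | _, _ => false
  end.

Lemma sgb_adj_sym : symmetric sgb_adj.
Proof. by case=> [[a b]|H] [[c d]|K]. Qed.

Lemma sgb_adj_irrefl : irreflexive sgb_adj.
Proof. by case=> [[a b]|H]. Qed.

Definition sgb_graph : sgraph := SGraph sgb_adj_sym sgb_adj_irrefl.

End SubgroupGeneratingBipartiteGraph.

(* G is isomorphic to the group presented by
   < a, b : a ^ (2 m) = 1, b ^ 2 = a ^ m, b a b^-1 = a^-1 >.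
   The Grp notation only characterizes the largest finite quotient of a
   presented group, but this one is finite. *)
Definition dicyclic (gT : finGroupType) (G : {group gT}) (m : nat) : Prop :=
  (G \isog Grp (a : b : a ^+ (2 * m)%N = 1, b ^+ 2 = a ^+ m,
                        b * a * b^-1 = a^-1))%g.

(* Main.v *)
Require Import Defs.
From mathcomp Require Import all_boot all_order all_algebra all_fingroup.
From mathcomp Require Import ring.

Set Implicit Arguments.
Unset Strict Implicit.
Unset Printing Implicit Defensive.

Import Order.TTheory GRing.Theory Num.Theory.

Local Open Scope ring_scope.

(** Every pair (a, b) of group elements has exactly one neighbour, namely the
    subgroup that it generates, so the graph is a disjoint union of stars, one
    star K_(1,n) for each subgroup H, where n = n_H is the number of pairs that
    generate H. A star with n >= 1 leaves has adjacency eigenvalues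
    sqrt n, - sqrt n and 0 (n - 1 times), while its Laplacian and its signless
    Laplacian both have eigenvalues 0, n + 1 and 1 (n - 1 times). With d the
    average degree of the whole graph, the star of H therefore contributes
    2 sqrt n to the energy and
      |0 - d| + |n + 1 - d| + (n - 1) |1 - d|
    to both Laplacian energies, which are then equal. The two formulas remain
    correct for n = 0, where the star is an isolated vertex and the second one
    reduces to |d|.

    The energies are compared star by star ([star_energy_le]). A graph in which
    each edge has its own pair (a, b) has fewer edges than vertices, so
    0 <= d <= 2. Hence for n >= 1 the Laplacian contribution is
    n + 1 + (n - 1) |1 - d|, which is at least n + 1 >= 2 sqrt n by the
    arithmetic-geometric mean inequality, strictly if n > 1. A star with n > 1
    exists as soon as there is an element x <> 1, because (x, 1) and (1, x) both
    generate <[x]>; and a dicyclic group has such an element since it maps onto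
    the group of order 2 ([dicyclic_ntriv]).

    The multiplicities come from the characteristic polynomial of a union of
    stars ([char_poly_star_forest_mx]), by a Schur complement; eigenvalue sums
    are then read off by unique factorization
    ([sum_eigenvalues_star_forest_mx]). *)

(** * Determinants of matrices indexed by a disjoint union *)

Lemma det_mxsub_inj (R : comNzRingType) n m (f : 'I_n -> 'I_m) (M : 'M[R]_m) :
  n = m -> injective f -> \det (mxsub f f M) = \det M.
Proof.
move=> eq_nm; case: m / eq_nm in f M * => f_inj.
have ->: mxsub f f M = row_perm (perm f_inj) (col_perm (perm f_inj) M).
  by apply/matrixP=> i j; rewrite !mxE !permE.
rewrite row_permE col_permE !det_mulmx !det_perm mulrCA.
by rewrite -signr_addb odd_permV addbb mulr1.
Qed.

(** The enumeration of a sum type is not assumed to list the left summand first: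
    any bijective renumbering acts by the same permutation on the rows and on
    the columns, so that the two signs cancel. *)
Lemma det_sum_type (R : comNzRingType) (A B : finType)
    (F : A + B -> A + B -> R) :
  \det (\matrix_(i < #|{: A + B}|, j < #|{: A + B}|)
          F (enum_val i) (enum_val j)) =
  \det (block_mx
    (\matrix_(i < #|A|, j < #|A|) F (inl (enum_val i)) (inl (enum_val j)))
    (\matrix_(i < #|A|, j < #|B|) F (inl (enum_val i)) (inr (enum_val j)))
    (\matrix_(i < #|B|, j < #|A|) F (inr (enum_val i)) (inl (enum_val j)))
    (\matrix_(i < #|B|, j < #|B|) F (inr (enum_val i)) (inr (enum_val j)))).
Proof.
pose g (u : A + B) : 'I_(#|A| + #|B|) :=
  match u with
  | inl a => lshift _ (enum_rank a)
  | inr b => rshift _ (enum_rank b)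
  end.
have g_inj : injective g.
  move=> [a|b] [a'|b'] /eqP; rewrite /g.
  - by rewrite eq_lshift => /eqP/enum_rank_inj->.
  - by rewrite eq_lrshift.
  - by rewrite eq_rlshift.
  - by rewrite eq_rshift => /eqP/enum_rank_inj->.
pose f (i : 'I_#|{: A + B}|) := g (enum_val i).
rewrite -[RHS](@det_mxsub_inj _ _ _ f) ?card_sum //; last first.
  exact: inj_comp g_inj enum_val_inj.
congr (\det _); apply/matrixP=> i j; rewrite [LHS]mxE [RHS]mxE /f.
by case: (enum_val i) => u; case: (enum_val j) => v;
  rewrite ?(block_mxEul, block_mxEur, block_mxEdl, block_mxEdr) mxE !enum_rankK.
Qed.

(** * The spectrum of a disjoint union of stars *)

Section StarForest.
(* The stars have their centres in B, and each leaf a is joined to phi a. *)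
Variables (A B : finType) (phi : A -> B).

Definition leaves (b : B) : nat := #|[pred a | phi a == b]|.

Lemma sum_leaves : (\sum_b leaves b)%N = #|A|.
Proof.
rewrite -sum1_card (partition_big phi xpredT) //=.
by apply: eq_bigr => b _; rewrite /leaves -sum1_card.
Qed.

(** The matrix e D + s A of the graph on A + B that joins each a to phi a, where D
    is its degree matrix and A its adjacency matrix: (e, s) = (0, 1), (1, -1) and
    (1, 1) give the three matrices whose energies are compared. *)
Definition star_forest_mx (R : comNzRingType) (e s : R) : 'M[R]_#|{: A + B}| :=
  \matrix_(i, j) match enum_val i, enum_val j with
    | inl a, inl a' => (a == a')%:R * e
    | inl a, inr b | inr b, inl a => (phi a == b)%:R * s
    | inr b, inr b' => (b == b')%:R * (e * (leaves b)%:R)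
    end.

(** With E the incidence matrix of centres against leaves (times s), the
    characteristic matrix is ((q, - E^T), (- E, N)) for q = X - e scalar and N
    diagonal. The rows of E have disjoint supports, so that E E^T is diagonal
    with entries [leaves b], and multiplying on the left by ((1, 0), (E, q))
    makes the matrix block triangular with diagonal lower block q N - E E^T. The
    factor q ^+ #|B| on the left is the determinant of the multiplier; keeping it
    there avoids a division by q. *)
Lemma char_poly_star_forest_mx (R : comNzRingType) (e s : R) : s ^+ 2 = 1 ->
  ('X - e%:P) ^+ #|B| * char_poly (star_forest_mx e s) =
  ('X - e%:P) ^+ #|A| *
    \prod_b (('X - e%:P) * ('X - (e * (leaves b)%:R)%:P) - (leaves b)%:R).
Proof.
move=> s2; set q := 'X - e%:P.
pose F (u v : A + B) : {poly R} := match u, v with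
    | inl a, inl a' => (a == a')%:R * q
    | inl a, inr b | inr b, inl a => - ((phi a == b)%:R * s%:P)
    | inr b, inr b' => (b == b')%:R * ('X - (e * (leaves b)%:R)%:P)
    end.
have -> : char_poly (star_forest_mx e s) =
    \det (\matrix_(i < #|{: A + B}|, j < #|{: A + B}|)
            F (enum_val i) (enum_val j)).
  congr (\det _); apply/matrixP=> i j; rewrite !mxE -(inj_eq enum_val_inj) /F.
  case: (enum_val i) => u; case: (enum_val j) => v.
  - rewrite -[inl u == inl v]/(u == v).
    by case: eqP; rewrite ?mul1r ?mul0r ?subrr.
  - by rewrite sub0r polyCM rmorph_nat.
  - by rewrite sub0r polyCM rmorph_nat.
  - rewrite -[inr u == inr v]/(u == v).
    by case: eqP; rewrite ?mul1r ?mul0r ?subrr.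
rewrite det_sum_type.
pose E : 'M[{poly R}]_(#|B|, #|A|) :=
  \matrix_(i, j) ((phi (enum_val j) == enum_val i)%:R * s%:P).
pose N : 'rV[{poly R}]_#|B| := \row_j ('X - (e * (leaves (enum_val j))%:R)%:P).
pose S : 'rV[{poly R}]_#|B| :=
  \row_j (q * ('X - (e * (leaves (enum_val j))%:R)%:P)
          - (leaves (enum_val j))%:R).
rewrite [X in block_mx X](_ : _ = q%:M); last first.
  by apply/matrixP=> i j; rewrite !mxE /= (inj_eq enum_val_inj) mulr_natl.
rewrite [X in block_mx _ X](_ : _ = - E^T); last first.
  by apply/matrixP=> i j; rewrite !mxE.
rewrite [X in block_mx _ _ X](_ : _ = - E); last first.
  by apply/matrixP=> i j; rewrite !mxE.
rewrite [X in block_mx _ _ _ X](_ : _ = diag_mx N); last first.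
  apply/matrixP=> i j; rewrite !mxE /= (inj_eq enum_val_inj) mulr_natl.
  by case: eqP => // ->.
have EEt : q%:M *m diag_mx N - E *m E^T = diag_mx S.
  apply/matrixP=> i j; rewrite mul_scalar_mx !mxE.
  (* the entries of E *m E^T; s ^+ 2 = 1 removes the sign *)
  rewrite [X in _ - X](_ : _ = (leaves (enum_val i))%:R *+ (i == j)); last first.
    rewrite (eq_bigr (fun k : 'I_#|A| =>
        (phi (enum_val k) == enum_val i)%:R *+ (i == j))).
      rewrite sumrMnl; congr (_ *+ _).
      rewrite -(big_enum_val (fun a => (phi a == enum_val i)%:R)) /=.
      rewrite /leaves -sum1_card natr_sum big_mkcond [RHS]big_mkcond /=.
      by apply: eq_bigr => a _; rewrite inE; case: eqP.
    move=> k _; rewrite !mxE.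
    have s2P : s%:P * s%:P = 1 :> {poly R} by rewrite -polyCM -expr2 s2.
    rewrite mulrACA s2P mulr1 -natrM mulnb -[RHS]mulr_natr -natrM mulnb.
    case: (eqVneq i j) => [->|ne_ij]; first by rewrite andbb andbT.
    rewrite andbF; case: eqP => //= ->.
    by rewrite (inj_eq enum_val_inj) (negPf ne_ij).
  by case: eqP => [->|_]; rewrite ?mulr0n ?mulr1n ?mulr0 ?subr0.
have := det_mulmx (block_mx 1%:M 0 E q%:M)
  (block_mx q%:M (- E^T) (- E) (diag_mx N)).
rewrite det_lblock det1 det_scalar mul1r => <-.
rewrite mulmx_block !mul1mx !mul0mx !addr0 !mulmxN scalar_mxC subrr.
rewrite [- _ + _]addrC EEt det_ublock det_scalar det_diag.
congr (_ * _).
rewrite (big_enum_val (fun b =>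
  q * ('X - (e * (leaves b)%:R)%:P) - (leaves b)%:R)) /=.
by apply: eq_bigr => i _; rewrite mxE.
Qed.

(** The two hypotheses on r1 and r2 say that r1 b and r2 b are the roots of the
    quadratic factor of b in [char_poly_star_forest_mx]. Unique factorization
    turns that polynomial identity into an equality of multisets, and #|A| is
    the sum of the [leaves b], so that the copies of e can be charged to the
    stars. The difference [leaves b - 1] is expanded since it is negative at an
    isolated centre. *)
Lemma sum_eigenvalues_star_forest_mx (C : numClosedFieldType) (e s : C)
    (r1 r2 : B -> C) (f : C -> C) :
  s ^+ 2 = 1 ->
  (forall b, r1 b + r2 b = e * (leaves b).+1%:R) ->
  (forall b, r1 b * r2 b = e ^+ 2 * (leaves b)%:R - (leaves b)%:R) ->
  \sum_(x <- eigenvalues (star_forest_mx e s)) f x =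
  \sum_b (f (r1 b) + f (r2 b) + (leaves b)%:R * f e - f e).
Proof.
move=> s2 sum_r mul_r.
have r_factor b : ('X - e%:P) * ('X - (e * (leaves b)%:R)%:P) - (leaves b)%:R =
    ('X - (r1 b)%:P) * ('X - (r2 b)%:P).
  have sumP : (r1 b)%:P + (r2 b)%:P = e%:P * (leaves b)%:R + e%:P.
    by rewrite -polyCD sum_r -addn1 natrD mulrDr mulr1 polyCD polyCM rmorph_nat.
  have mulP : (r1 b)%:P * (r2 b)%:P = e%:P ^+ 2 * (leaves b)%:R - (leaves b)%:R.
    by rewrite -polyCM mul_r polyCB polyCM !rmorph_nat rmorphXn.
  transitivity ('X ^+ 2 - ((r1 b)%:P + (r2 b)%:P) * 'X + (r1 b)%:P * (r2 b)%:P).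
    by rewrite sumP mulP polyCM rmorph_nat; ring.
  ring.
pose ev := eigenvalues (star_forest_mx e s).
have eq_roots : perm_eq (nseq #|B| e ++ ev)
    (nseq #|A| e ++ map r1 (index_enum B) ++ map r2 (index_enum B)).
  apply: prod_XsubC_eq.
  rewrite !big_cat /= !big_nseq !iter_mulr_1 !big_map /= -eigenvaluesP.
  rewrite char_poly_star_forest_mx // -big_split /=.
  by under eq_bigr do rewrite r_factor.
have := perm_big _ eq_roots (op := +%R) (x := 0) (P := xpredT) (F := f).
rewrite !big_cat /= !big_nseq !iter_addr_0 !big_map /= => /(canRL (addKr _)) ->.
rewrite sumrB !big_split /= -mulr_suml -natr_sum sum_leaves.
rewrite sumr_const mulr_natl.
ring.
Qed.
End StarForest.

(** * Comparing the energies on one star *)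

(** For n >= 1 the bound d <= 2 <= n + 1 removes the second absolute value, and
    the right side exceeds the left one by (sqrt n - 1) ^+ 2 + (n - 1) |1 - d|. *)
Lemma star_energy_le (C : numClosedFieldType) (n : nat) (d : C) :
  0 <= d <= 2 ->
  sqrtC n%:R + sqrtC n%:R <=
    `|0 - d| + `|n.+1%:R - d| + n%:R * `|1 - d| - `|1 - d| ?= iff
  if n is n'.+1 then (n' == 0)%N else (d == 0).
Proof.
case/andP=> d_ge0 d_le2; rewrite sub0r normrN (ger0_norm d_ge0).
case: n => [|n].
  rewrite sqrtC0 mul0r !addr0 addrK; split=> //; exact: eq_sym.
have d_le_n : d <= n.+2%:R by apply: le_trans d_le2 _; rewrite ler_nat.
rewrite [`|n.+2%:R - d|]ger0_norm ?subr_ge0 //.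
set r := sqrtC n.+1%:R.
have r2 : r ^+ 2 = n%:R + 1 by rewrite sqrtCK -natr1.
have r_real : r - 1 \is Num.real.
  by rewrite rpredB // ?sqrtC_real ?ler0n // rpred1.
have -> : d + (n.+2%:R - d) + n.+1%:R * `|1 - d| - `|1 - d| =
    r + r + ((r - 1) ^+ 2 + n%:R * `|1 - d|).
  rewrite sqrrB r2 -![_.+1%:R]natr1 mulr1; ring.
have sq_ge0 : 0 <= (r - 1) ^+ 2 by rewrite real_exprn_even_ge0.
have nd_ge0 : 0 <= n%:R * `|1 - d| by rewrite mulr_ge0.
split; first by rewrite lerDl addr_ge0.
rewrite -subr_eq0 opprD addNKr oppr_eq0 paddr_eq0 // sqrf_eq0 subr_eq0.
case: n @r r2 {r_real sq_ge0 nd_ge0 d_le_n} => [|n] r r2.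
  by rewrite mul0r /r sqrtC1 !eqxx.
apply/negP=> /andP[/eqP r1 _]; move/eqP: r2.
by rewrite r1 expr1n natr1 eq_sym pnatr_eq1.
Qed.

(** * The energies of the subgroup generating bipartite graph *)

Section SubgroupGeneratingGraph.
Variable gT : finGroupType.

Definition gen_pair (q : gT * gT) : {group gT} := <<[set q.1; q.2]>>%G.

Lemma sgb_adj_lr q (H : {group gT}) :
  sgb_adj (inl q) (inr H) = (gen_pair q == H).
Proof. by case: q. Qed.

Lemma sgb_adj_rl q (H : {group gT}) :
  sgb_adj (inr H) (inl q) = (gen_pair q == H).
Proof. by case: q. Qed.

Lemma degree_pair (q : gT * gT) : @degree (sgb_graph gT) (inl q) = 1%N.
Proof.
rewrite /degree -(cards1 (inr (gen_pair q) : gT * gT + {group gT})).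
apply: eq_card => -[q'|H]; rewrite !inE; first by case: q.
by rewrite [LHS]sgb_adj_lr eq_sym.
Qed.

Lemma degree_subgroup (H : {group gT}) :
  @degree (sgb_graph gT) (inr H) = leaves gen_pair H.
Proof.
have inl_inj : injective (@inl (gT * gT) {group gT}) by move=> ? ? [].
rewrite /degree /leaves -(card_imset _ inl_inj).
apply: eq_card => -[q|K]; rewrite !inE.
  by rewrite mem_imset // inE; apply: sgb_adj_rl.
by apply/esym/negbTE/imsetP => -[].
Qed.

Lemma sgb_mxE (C : numClosedFieldType) (e s : C) :
  e *: degree_mx C (sgb_graph gT) + s *: adjacency_mx C (sgb_graph gT) =
  star_forest_mx gen_pair e s.
Proof.
apply/matrixP=> i j; rewrite !mxE -(inj_eq enum_val_inj).
case: (enum_val i) => u; case: (enum_val j) => v.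
- rewrite degree_pair -[inl u == inl v]/(u == v).
  have -> : sedge (inl u : sgb_graph gT) (inl v) = false by case: u.
  by rewrite mulr0 addr0 mulr_natl mulrnAr mulr1.
- by rewrite mulr0 add0r [sedge _ _]sgb_adj_lr mulrC.
- by rewrite mulr0 add0r [sedge _ _]sgb_adj_rl mulrC.
- rewrite degree_subgroup -[inr u == inr v]/(u == v).
  have -> : sedge (inr u : sgb_graph gT) (inr v) = false by exact: erefl.
  by rewrite mulr0 addr0 [RHS]mulr_natl -mulrnAr.
Qed.

(** Mapping a pair to the edge through it is onto the edges, so there are at most
    as many edges as pairs. *)
Lemma card_edges_sgb : (#|edges (sgb_graph gT)| <= #|sgb_graph gT|)%N.
Proof.
pose edge_of (q : gT * gT) : {set sgb_graph gT} :=
  [set inl q; inr (gen_pair q)].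
apply: (@leq_trans #|edge_of @: [set: gT * gT]|); last first.
  apply: leq_trans (leq_imset_card _ _) _.
  by rewrite cardsT [#|sgb_graph gT|]card_sum leq_addr.
apply/subset_leq_card/subsetP=> x /imset2P[u v _].
rewrite inE => /andP[_ uv] ->.
case: u v uv => [q|H] [q'|K].
- by case: q.
- by rewrite [sedge _ _]sgb_adj_lr => /eqP<-; apply: imset_f.
- rewrite [sedge _ _]sgb_adj_rl => /eqP<-.
  by rewrite setUC; apply: imset_f.
- by [].
Qed.

Lemma average_degree_sgb (C : numClosedFieldType) :
  0 <= average_degree C (sgb_graph gT) <= 2.
Proof.
rewrite /average_degree; apply/andP; split; first by rewrite divr_ge0 ?ler0n.
have V_gt0 : (0 : C) < #|sgb_graph gT|%:R.
  by rewrite ltr0n; apply/card_gt0P; exists (inr 1%G).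
by rewrite ler_pdivrMr // -natrM ler_nat leq_mul2l card_edges_sgb.
Qed.

Section Energies.
Variable C : numClosedFieldType.
Local Notation n := (leaves gen_pair).

Lemma energy_sgb :
  energy C (sgb_graph gT) =
  \sum_(H : {group gT}) (sqrtC (n H)%:R + sqrtC (n H)%:R).
Proof.
rewrite /energy.
have -> : adjacency_mx C (sgb_graph gT) = star_forest_mx gen_pair 0 1.
  by rewrite -sgb_mxE scale0r scale1r add0r.
rewrite (@sum_eigenvalues_star_forest_mx _ _ _ _ _ _
  (fun H => sqrtC (n H)%:R) (fun H => - sqrtC (n H)%:R)).
- apply: eq_bigr => H _; rewrite normr0 mulr0 addr0 subr0 normrN ger0_norm //.
  by rewrite sqrtC_ge0 ler0n.
- by rewrite expr1n.
- by move=> H; rewrite subrr mul0r.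
- by move=> H; rewrite mulrN -expr2 sqrtCK expr0n mul0r sub0r.
Qed.

(** Only s ^+ 2 enters the characteristic polynomial, which is why s = -1 and
    s = 1, that is the Laplacian and the signless Laplacian, have the same
    spectrum. *)
Lemma sum_laplacian_sgb (s : C) (f : C -> C) : s ^+ 2 = 1 ->
  \sum_(x <- eigenvalues (degree_mx C (sgb_graph gT) +
                          s *: adjacency_mx C (sgb_graph gT))) f x =
  \sum_(H : {group gT}) (f 0 + f (n H).+1%:R + (n H)%:R * f 1 - f 1).
Proof.
move=> s2.
rewrite -[degree_mx _ _]scale1r sgb_mxE.
rewrite (@sum_eigenvalues_star_forest_mx _ _ _ _ _ _
  (fun=> 0) (fun H => (n H).+1%:R)) // => H.
  by rewrite add0r mul1r.
by rewrite mul0r expr1n mul1r subrr.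
Qed.

Lemma laplacian_energy_sgb (d := average_degree C (sgb_graph gT)) :
  laplacian_energy C (sgb_graph gT) =
  \sum_(H : {group gT})
     (`|0 - d| + `|(n H).+1%:R - d| + (n H)%:R * `|1 - d| - `|1 - d|).
Proof.
rewrite /laplacian_energy -scaleN1r.
by rewrite (@sum_laplacian_sgb (-1) (fun x => `|x - d|)) // sqrrN expr1n.
Qed.

Lemma signless_laplacian_energy_sgb :
  signless_laplacian_energy C (sgb_graph gT) = laplacian_energy C (sgb_graph gT).
Proof.
rewrite laplacian_energy_sgb /signless_laplacian_energy.
rewrite -[adjacency_mx _ _]scale1r.
by rewrite (@sum_laplacian_sgb 1 (fun x => `|x - _|)) // expr1n.
Qed.

(** The leaves (x, 1) and (1, x) of the star of <[x]> are distinct, so the comparison is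
    strict there. *)
Lemma energy_lt_laplacian_energy_sgb (x : gT) : x != 1%g ->
  energy C (sgb_graph gT) < laplacian_energy C (sgb_graph gT).
Proof.
move=> x_neq1; rewrite energy_sgb laplacian_energy_sgb.
have le_star H := star_energy_le (n H) (average_degree_sgb C).
rewrite (bigD1 <[x]>%G) //= [ltRHS](bigD1 <[x]>%G) //=.
apply: ltr_leD; last by apply: ler_sum => H _; apply: (le_star H).1.
rewrite lt_neqAle (le_star _).1 (le_star _).2 andbT.
have : (1 < n <[x]>%G)%N.
  have <- : #|[set (x, 1%g); (1%g, x)]| = 2%N.
    by rewrite cards2 xpair_eqE (negPf x_neq1).
  apply/subset_leq_card/subsetP => q; rewrite !inE.
  case/orP=> /eqP->; apply/eqP/group_inj.
    exact: (etrans (esym (joing_idl [set x]%g 1%g)) (joingG1 <[x]>%G)).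
  exact: (etrans (esym (joing_idr 1%g [set x]%g)) (joing1G <[x]>%G)).
by case: (n _) => // -[].
Qed.

End Energies.
End SubgroupGeneratingGraph.

(** * Dicyclic groups are nontrivial *)

(** The relations hold in the group of order 2 when a is sent to 1 and b to the
    element of order 2, so this group is a quotient of G. *)
Lemma dicyclic_ntriv (gT : finGroupType) (G : {group gT}) (m : nat) :
  dicyclic G m -> G :!=: 1%g.
Proof.
move=> isoG; apply/eqP=> G1.
pose b : 'I_2 := 1%R.
have : ([set: 'I_2] \homg G)%g.
  rewrite isoG; apply/existsP; exists (1%g, b).
  rewrite /= !xpair_eqE cycle1 joing1G [X in _ == X]Zp_cycle.
  by apply/and4P; split; rewrite ?expg1n ?mulg1 ?mulgV ?invg1.
by move/leq_homg; rewrite G1 cards1 cardsT card_ord.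
Qed.

Theorem theorem4p8 (C : numClosedFieldType) (p : nat) (gT : finGroupType)
    (hp : prime p) (hG : dicyclic [set: gT]%G (p ^ 2)) :
  energy C (sgb_graph gT) < laplacian_energy C (sgb_graph gT) /\
  laplacian_energy C (sgb_graph gT) = signless_laplacian_energy C (sgb_graph gT).
Proof.
split; last by rewrite signless_laplacian_energy_sgb.
have /trivgPn[x _ x_neq1] := dicyclic_ntriv hG.
exact: energy_lt_laplacian_energy_sgb x_neq1.
Qed.
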